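(* Assume the bounded loss condition $\sup_{f,g\in\mathcal F}\operatorname{ess\,sup}|\ell_f(Z)-\ell_g(Z)|\le \tfrac12$. Let $n\ge 1$ and $\eta>0$. For every randomized estimator $\hat\Pi$ and every luckiness function $w:\mathcal Z^n\times\mathcal F\to[0,\infty)$ with $0<S_\eta(\mathcal F,\hat\Pi,w)<\infty$, one has, with $Z^n\sim P$, $$\mathbb E_{f\sim\hat\Pi\mid Z^n}\Big[\mathbb E^{\mathrm{ann},\eta}_{\bar Z\sim P}\big[R_f(\bar Z)\big]\Big]\ \trianglelefteq^{*}_{n\eta}\ \frac1n\,\mathrm{COMP}^{\mathrm{full}}_\eta(\mathcal F,\hat\Pi,w,Z^n),$$ that is, $$\mathbb E_{Z^n\sim P}\Big[\exp\Big(n\eta\Big(\mathbb E_{f\sim\hat\Pi\mid Z^n}\big[\mathbb E^{\mathrm{ann},\eta}_{\bar Z\sim P}[R_f(\bar Z)]\big]-\tfrac1n\mathrm{COMP}^{\mathrm{full}}_\eta(\mathcal F,\hat\Pi,w,Z^n)\Big)\Big)\Big]=1 .$$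
   Context: $Z_1,\dots,Z_n$ are i.i.d. from a probability distribution $P$ on $\mathcal Z=\mathcal X\times\mathcal Y$; $Z^n=(Z_1,\dots,Z_n)$, and $Z^n\sim P$ means i.i.d. sampling. $\mathcal F$ is a model (a measurable space of predictors), $\ell_f(z)\in\mathbb R$ is the loss of $f\in\mathcal F$ on $z$, and $f^*\in\mathcal F$ is a minimizer of $f\mapsto\mathbb E_{Z\sim P}[\ell_f(Z)]$ over $\mathcal F$ (assumed to exist). $R_f(z)=\ell_f(z)-\ell_{f^*}(z)$ and $R_f(z^n)=\sum_{i=1}^nR_f(z_i)$. All functions are assumed measurable, and the expectations appearing below are assumed well-defined. A randomized estimator $\hat\Pi$ maps each $z^n\in\mathcal Z^n$ to a probability distribution $\hat\Pi\mid z^n$ on $\mathcal F$. For $\eta>0$: - $C(f)=\mathbb E_{Z^n\sim P}[e^{-\eta R_f(Z^n)}]$; - $S_\eta(\mathcal F,\hat\Pi,w)=\mathbb E_{Z^n\sim P}\big[\exp\big(-\mathbb E_{f\sim\hat\Pi\mid Z^n}[\eta R_f(Z^n)+\log C(f)-\log w(Z^n,f)]\big)\big]$; - $\mathrm{COMP}_\eta(\mathcal F,\hat\Pi,w,z^n)=\frac1\eta\big(\mathbb E_{f\sim\hat\Pi\mid z^n}[-\log w(z^n,f)]+\log S_\eta(\mathcal F,\hat\Pi,w)\big)$; - $\mathrm{COMP}^{\mathrm{full}}_\eta(\mathcal F,\hat\Pi,w,z^n)=\mathrm{COMP}_\eta(\mathcal F,\hat\Pi,w,z^n)+\mathbb E_{f\sim\hat\Pi\mid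 z^n}[R_f(z^n)]$. Annealed expectation: $\mathbb E^{\mathrm{ann},\eta}[U]=-\frac1\eta\log\mathbb E[e^{-\eta U}]$. Exponential stochastic inequality: $U\trianglelefteq_\eta U'$ means $\mathbb E[e^{\eta(U-U')}]\le1$, and $U\trianglelefteq^*_\eta U'$ means equality holds. *)

(* Defs.v *)
From HB Require Import structures.
From mathcomp Require Import all_boot all_order all_algebra.
From mathcomp Require Import all_classical all_reals all_analysis.
From mathcomp Require Import ess_sup_inf.

Set Implicit Arguments.
Unset Strict Implicit.
Unset Printing Implicit Defensive.

Import Order.TTheory GRing.Theory Num.Theory.
Import numFieldNormedType.Exports.

Local Open Scope classical_set_scope.
Local Open Scope ring_scope.
Local Open Scope ereal_scope.

Section tuple_cons.
Context d (T : measurableType d) (n : nat).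

Definition tuple_cons (x : T * n.-tuple T) : n.+1.-tuple T :=
  [tuple of x.1 :: x.2].

Let measurable_tuple_cons : measurable_fun [set: T * n.-tuple T] tuple_cons.
Proof. exact: measurable_cons. Qed.

HB.instance Definition _ :=
  isMeasurableFun.Build _ _ _ _ tuple_cons measurable_tuple_cons.

End tuple_cons.

(* The [n]-fold product law of [P]: the law of an i.i.d. sample of size [n].
   [iid_rectangle] below characterizes it. *)
Fixpoint iid d (T : measurableType d) (R : realType) (P : probability T R)
    (n : nat) : probability (n.-tuple T) R :=
  match n with
  | 0 => \d_([tuple])
  | m.+1 => distribution (P \x iid P m) (@tuple_cons _ T m)
  end.

Lemma iid_rectangle d (T : measurableType d) (R : realType)
    (P : probability T R) (n : nat) (A : 'I_n -> set T) :
  (forall i, measurable (A i)) ->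
  iid P n [set z | forall i, A i (tnth z i)] = \prod_(i < n) P (A i).
Proof.
elim: n A => [|n ih] A mA /=.
  by rewrite big_ord0 diracE mem_set//= => -[].
rewrite big_ord_recl -ih; last by move=> i; exact: mA.
rewrite /distribution /pushforward /=.
rewrite (_ : _ @^-1` _ = A ord0 `*`
    [set z : n.-tuple T | forall i, A (lift ord0 i) (tnth z i)]).
  rewrite product_measure1E//.
  rewrite (_ : mkset _ = \bigcap_(i in [set: 'I_n])
      ((fun z => tnth z i) @^-1` A (lift ord0 i))).
    apply: fin_bigcap_measurable => // i _; rewrite -[X in measurable X]setTI.
    exact: measurable_tnth.
  by apply/seteqP; split => z /= H i; [move=> _; exact: H|exact: H].
apply/seteqP; split => -[x z] /=.
  move=> H; split; first exact: (H ord0).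
  by move=> i; have := H (lift ord0 i); rewrite tnthS.
move=> [H0 H] i; case: (unliftP ord0 i) => [j|] ->; last exact: H0.
by rewrite tnthS; exact: H.
Qed.

Section stochastic_inequalities.
Context d (T : measurableType d) (R : realType).

(* [\int[mu]_x f x] is [\int f^\+ - \int f^\-]; it is a well-defined extended
   real unless this difference reads [+oo - +oo]. *)
Definition integral_defined (mu : {measure set T -> \bar R}) (f : T -> \bar R) :=
  \int[mu]_x f^\+ x < +oo \/ \int[mu]_x f^\- x < +oo.

Definition annealed (mu : {measure set T -> \bar R}) (eta : R) (U : T -> R) :
    \bar R :=
  - ((eta^-1)%:E * lne (\int[mu]_x (expR (- (eta * U x)))%:E)).

(* Exponential stochastic inequality with equality, [U <=*_eta V]. *)
Definition esi_eq (mu : {measure set T -> \bar R}) (eta : R)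
    (U V : T -> \bar R) : Prop :=
  \int[mu]_x expeR (eta%:E * (U x - V x)) = 1.

End stochastic_inequalities.

Section learning.
Context dZ dF (Z : measurableType dZ) (F : measurableType dF) (R : realType).
Implicit Types (P : probability Z R) (loss : F -> Z -> R) (f fstar : F).

Definition risk P loss f : \bar R := \int[P]_z (loss f z)%:E.

Definition risk_minimizer P loss fstar :=
  forall f, risk P loss fstar <= risk P loss f.

Definition bounded_loss P loss :=
  ereal_sup [set ess_sup P (fun z => `|loss fg.1 z - loss fg.2 z|%:E)
            | fg in [set: F * F]] <= (2^-1)%:E.

Definition excess_loss loss fstar f (z : Z) : R := (loss f z - loss fstar z)%R.

Definition excess_loss_sum loss fstar n f (zn : n.-tuple Z) : R :=
  (\sum_(i < n) excess_loss loss fstar f (tnth zn i))%R.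

Definition norm_const P loss fstar (n : nat) (eta : R) f : \bar R :=
  \int[iid P n]_zn (expR (- (eta * excess_loss_sum loss fstar f zn)))%:E.

(* A luckiness function may vanish, with [- log 0 = +oo]: [lne] and [expeR] are
   the extended logarithm and exponential, so that the quantities below are
   extended reals. *)
Definition Seta P loss fstar n (eta : R) (Pi : R.-pker (n.-tuple Z) ~> F)
    (w : n.-tuple Z -> F -> R) : \bar R :=
  \int[iid P n]_zn expeR (- \int[Pi zn]_f
    ((eta * excess_loss_sum loss fstar f zn)%:E
      + lne (norm_const P loss fstar n eta f) - lne (w zn f)%:E)).

Definition COMP P loss fstar n (eta : R) (Pi : R.-pker (n.-tuple Z) ~> F)
    (w : n.-tuple Z -> F -> R) (zn : n.-tuple Z) : \bar R :=
  (eta^-1)%:E * (\int[Pi zn]_f (- lne (w zn f)%:E)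
                 + lne (Seta P loss fstar eta Pi w)).

Definition COMP_full P loss fstar n (eta : R) (Pi : R.-pker (n.-tuple Z) ~> F)
    (w : n.-tuple Z -> F -> R) (zn : n.-tuple Z) : \bar R :=
  COMP P loss fstar eta Pi w zn
  + \int[Pi zn]_f (excess_loss_sum loss fstar f zn)%:E.

End learning.

(* Main.v *)
(** Write [m f] for the logarithm of [E exp(- eta R_f(Z))].  The bounded loss
    condition gives [|m f| <= eta / 2], so [m] is integrable for every
    posterior, the annealed risk of [f] is [- m f / eta], and, by independence,
    [log C(f) = n m(f)].  Hence, up to the additive constant [- log S], the
    exponent [n eta (E_f[annealed risk] - COMPfull / n)] is the exponent whose
    exponential [S] integrates, and the integral is [S / S = 1].
    The empirical excess loss is not bounded for every sample (the exceptional
    null set depends on [f]), so the posterior integrals of [R_f(z^n)] and of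
    [- log w] may be infinite; their additivity is only available because the
    hypotheses rule out [+oo - +oo]. *)
Require Import Defs.
From HB Require Import structures.
From mathcomp Require Import all_boot all_order all_algebra.
From mathcomp Require Import all_classical all_reals all_analysis.
From mathcomp Require Import measurable_realfun ess_sup_inf ring lra.

Set Implicit Arguments.
Unset Strict Implicit.
Unset Printing Implicit Defensive.

Import Order.TTheory GRing.Theory Num.Theory.
Import numFieldNormedType.Exports.

Local Open Scope classical_set_scope.
Local Open Scope ring_scope.
Local Open Scope ereal_scope.

(** * Measurability of extended-real maps and kernel integrals; integration of products against the
    i.i.d. law *)

Lemma measurable_lne (R : realType) : measurable_fun [set: \bar R] (@lne R).
Proof.
rewrite (_ : @lne R = fun x => if 0 < x then
    (if x == +oo then +oo else (ln (fine x))%:E) else -oo).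
  apply: measurable_fun_ifT => //; first exact: measurable_fun_lte.
  apply: measurable_fun_ifT => //; first exact: measurable_fun_eqe.
  apply/measurable_EFinP.
  exact: measurableT_comp (@measurable_ln R) (fine_measurable measurableT).
apply/funext => -[r| |] /=; rewrite ?eqxx ?ltry ?ltNge ?leNye //.
by rewrite lee_fin; case: ifP.
Qed.

Lemma measurable_expeR (R : realType) : measurable_fun [set: \bar R] (@expeR R).
Proof.
rewrite (_ : @expeR R = fun x => if x == +oo then +oo else
    if x == -oo then 0 else (expR (fine x))%:E).
  apply: measurable_fun_ifT => //; first exact: measurable_fun_eqe.
  apply: measurable_fun_ifT => //; first exact: measurable_fun_eqe.
  apply/measurable_EFinP.
  exact: measurableT_comp (@measurable_expR R) (fine_measurable measurableT).
by apply/funext => -[r| |].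
Qed.

(** No integrability is assumed: each part of [h] falls under the nonnegative case, and a difference
    of measurable extended-real functions is measurable because [+oo - +oo] has a fixed value. *)
Lemma measurable_integral_kernel d d' (X : measurableType d)
    (Y : measurableType d') (R : realType) (k : R.-pker X ~> Y)
    (h : X -> Y -> \bar R) :
  measurable_fun [set: X * Y] (fun xy => h xy.1 xy.2) ->
  measurable_fun [set: X] (fun x => \int[k x]_y h x y).
Proof.
move=> mh.
rewrite (_ : (fun x => _) = fun x => \int[k x]_y (h x)^\+ y
    - \int[k x]_y (h x)^\- y); last by apply/funext => x; rewrite integralE.
apply: emeasurable_funB.
- have := measurable_fun_integral_finite_kernel
    (fun xy => (h xy.1)^\+ xy.2) k; apply => [?|]; first exact: funepos_ge0.
  by have := measurable_funepos mh; rewrite unlock.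
- have := measurable_fun_integral_finite_kernel
    (fun xy => (h xy.1)^\- xy.2) k; apply => [?|]; first exact: funeneg_ge0.
  by have := measurable_funeneg mh; rewrite unlock.
Qed.

(** This is where independence enters. By induction, a change of variables along [tuple_cons] splits
    off the first coordinate, and Tonelli, available since [g] is nonnegative, pulls its factor
    out. *)
Lemma integral_iid_prod d (T : measurableType d) (R : realType)
    (P : probability T R) (n : nat) (g : T -> R) :
  measurable_fun [set: T] g -> (forall z, 0 <= g z)%R ->
  \int[iid P n]_zn (\prod_(i < n) g (tnth zn i))%:E = (\int[P]_z (g z)%:E) ^+ n.
Proof.
move=> mg g0.
have mprod m : measurable_fun [set: m.-tuple T]
    (fun zn : m.-tuple T => (\prod_(i < m) g (tnth zn i))%:E).
  apply/measurable_EFinP; apply: measurable_prod => i _.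
  by apply: measurableT_comp => //; exact: measurable_tnth.
elim: n => [|n ih].
  rewrite integral_dirac//; last exact: (mprod 0%N).
  by rewrite diracT mul1e big_ord0 expe0.
have g0E z : 0 <= (g z)%:E by rewrite lee_fin.
have -> : iid P n.+1 = distribution (P \x iid P n) (@tuple_cons _ T n) by [].
rewrite ge0_integral_distribution; [|exact: mprod|]; last first.
  by move=> z; rewrite lee_fin prodr_ge0.
have tc : (fun zn : n.+1.-tuple T => (\prod_(i < n.+1) g (tnth zn i))%:E) \o
    @tuple_cons _ T n =
    (fun x => (g x.1)%:E * (\prod_(i < n) g (tnth x.2 i))%:E).
  apply/funext => -[x z] /=; rewrite -EFinM big_ord_recl; congr (_ * _)%:E.
  by apply: eq_bigr => i _; rewrite tnthS.
rewrite tc fubini_tonelli1; last 2 first.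
- apply: emeasurable_funM.
    apply/measurable_EFinP; exact: measurableT_comp.
  exact: (measurableT_comp (mprod n)).
- by move=> x; rewrite mule_ge0// lee_fin prodr_ge0.
transitivity (\int[P]_x ((g x)%:E *
    \int[iid P n]_zn (\prod_(i < n) g (tnth zn i))%:E)).
  apply: eq_integral => x _; rewrite /fubini_F/= ge0_integralZl//.
    exact: mprod.
  by move=> z _; rewrite lee_fin prodr_ge0.
rewrite ge0_integralZr//; last 2 first.
- exact/measurable_EFinP.
- by apply: integral_ge0 => z _; rewrite lee_fin prodr_ge0.
by rewrite ih expeS.
Qed.

(** * Scaling and adding integrals that may be infinite *)

Lemma pmule_infty (R : realDomainType) (k : R) :
  (0 < k)%R -> k%:E * +oo = +oo /\ k%:E * -oo = -oo.
Proof. by move=> k0; rewrite gt0_muley ?gt0_muleNy ?lte_fin. Qed.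

(** A finite positive factor fixes both infinities, so the two sides resolve [+oo - +oo] by the same
    convention and no side condition on [x + y] arises. *)
Lemma pmuleDr (R : realDomainType) (k : R) (x y : \bar R) :
  (0 < k)%R -> k%:E * (x + y) = k%:E * x + k%:E * y.
Proof.
move=> k0; have [py pNy] := pmule_infty k0.
by case: x y => [x| |] [y| |] //=; rewrite ?(py, pNy)// -!EFinM mulrDr.
Qed.

Lemma integralZl_pos d (T : measurableType d) (R : realType)
    (mu : {measure set T -> \bar R}) (k : R) (f : T -> \bar R) :
  (0 < k)%R -> measurable_fun [set: T] f ->
  \int[mu]_x (k%:E * f x) = k%:E * \int[mu]_x f x.
Proof.
move=> k0 mf; rewrite integralE [in RHS]integralE.
rewrite ge0_funeposM ?ltW// ge0_funenegM ?ltW//.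
rewrite !ge0_integralZl// ?lee_fin ?(ltW k0)//.
- by rewrite -muleN -pmuleDr.
- exact: measurable_funeneg.
- exact: measurable_funepos.
Qed.

(** The letters stand for integrals of the positive and negative parts of a sum and of its two
    terms. If all are finite, the identity rearranges to the claim. If the right-hand side is
    infinite, definedness and the two bounds keep one of [p], [n] finite, and the identity forces
    the other to be [+oo]. *)
Lemma posneg_parts_add (R : realDomainType) (p n p1 n1 p2 n2 : \bar R) :
  0 <= p -> 0 <= n -> 0 <= p1 -> 0 <= n1 -> 0 <= p2 -> 0 <= n2 ->
  p + n1 + n2 = n + p1 + p2 -> p <= p1 + p2 -> n <= n1 + n2 ->
  p1 < +oo \/ n1 < +oo -> p2 < +oo \/ n2 < +oo ->
  p1 - n1 +? (p2 - n2) ->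
  p - n = p1 - n1 + (p2 - n2).
Proof.
case: p => [p| |]//; case: n => [n| |]//; case: p1 => [p1| |]//;
case: n1 => [n1| |]//; case: p2 => [p2| |]//;
case: n2 => [n2| |]//= _ _ _ _ _ _;
move=> // E _ _ [] // _ [] // _ _.
all: by congr EFin; case: E; lra.
Qed.

Lemma funepos_funeneg_EFinD (T : Type) (R : realDomainType) (f : T -> R)
    (g : T -> \bar R) (x : T) :
  let h y := (f y)%:E + g y in
  [/\ h^\+ x + (EFin \o f)^\- x + g^\- x =
      h^\- x + (EFin \o f)^\+ x + g^\+ x,
    h^\+ x <= (EFin \o f)^\+ x + g^\+ x &
    h^\- x <= (EFin \o f)^\- x + g^\- x].
Proof.
rewrite !unlock /=; case: (g x) => [s| |] /=; last 2 first.
- rewrite -!EFin_max maxye maxNye /= ?leey; split=> //.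
  by rewrite lee_fin addr0 le_max lexx orbT.
- rewrite -!EFin_max maxye maxNye /= ?leey; split=> //.
  by rewrite lee_fin addr0 le_max lexx orbT.
(* Fixing the signs of [f x], of [s] and of their sum makes every maximum linear, so that each sign
   pattern is left to [lra]. *)
have maxE (a : R) :
    (0 <= a /\ Num.max a 0 = a /\ Num.max (- a) 0 = 0 \/
     a <= 0 /\ Num.max a 0 = 0 /\ Num.max (- a) 0 = - a)%R.
  have [a0|/ltW a0] := leP 0%R a; [left|right]; do 2!split=> //.
    by apply: max_r; rewrite oppr_le0.
  by apply: max_l; rewrite oppr_ge0.
rewrite -!EFin_max -!EFinD !lee_fin.
case: (maxE (f x)) => -[? [-> ->]]; case: (maxE s) => -[? [-> ->]];
  case: (maxE (f x + s)%R) => -[? [-> ->]]; split; try congr EFin; lra.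
Qed.

(** Both parts of [g] have finite integrals, so whichever part of [f] has a finite integral passes
    this on to the same part of the sum, by domination. *)
Lemma integral_definedD d (T : measurableType d) (R : realType)
    (mu : {measure set T -> \bar R}) (f g : T -> R) :
  measurable_fun [set: T] f ->
  integral_defined mu (EFin \o f) -> mu.-integrable [set: T] (EFin \o g) ->
  integral_defined mu (fun x => (f x)%:E + (g x)%:E).
Proof.
move=> mf df ig.
have mf' : measurable_fun [set: T] (EFin \o f) by exact/measurable_EFinP.
have mg' := measurable_int _ ig.
have mh : measurable_fun [set: T] (fun x => (f x)%:E + (g x)%:E).
  exact: emeasurable_funD.
have mhp := measurable_funepos mh.
have mhn := measurable_funeneg mh.
have mfp := measurable_funepos mf'.
have mfn := measurable_funeneg mf'.
have mgp := measurable_funepos mg'.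
have mgn := measurable_funeneg mg'.
have gp := integral_funepos_lt_pinfty measurableT ig.
have gn := integral_funeneg_lt_pinfty measurableT ig.
have key := funepos_funeneg_EFinD f (EFin \o g).
case: df => fi; [left|right].
- apply: (@le_lt_trans _ _ (\int[mu]_x (EFin \o f)^\+ x +
      \int[mu]_x (EFin \o g)^\+ x)); last by rewrite lte_add_pinfty.
  rewrite -ge0_integralD//; apply: ge0_le_integral => //; last first.
    by move=> x _; have [] := key x.
  exact: emeasurable_funD.
- apply: (@le_lt_trans _ _ (\int[mu]_x (EFin \o f)^\- x +
      \int[mu]_x (EFin \o g)^\- x)); last by rewrite lte_add_pinfty.
  rewrite -ge0_integralD//; apply: ge0_le_integral => //; last first.
    by move=> x _; have [] := key x.
  exact: emeasurable_funD.
Qed.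

Lemma integral_definedZl d (T : measurableType d) (R : realType)
    (mu : {measure set T -> \bar R}) (k : R) (f : T -> \bar R) :
  (0 < k)%R -> measurable_fun [set: T] f ->
  integral_defined mu f -> integral_defined mu (fun x => k%:E * f x).
Proof.
move=> k0 mf df; rewrite /integral_defined.
rewrite ge0_funeposM ?(ltW k0)// ge0_funenegM ?(ltW k0)//.
rewrite !ge0_integralZl// ?lee_fin ?(ltW k0)//; last 2 first.
- exact: measurable_funeneg.
- exact: measurable_funepos.
by case: df => fi; [left|right]; apply: lte_mul_pinfty; rewrite // lee_fin ltW.
Qed.

(* As [f] is real-valued, [f x + g x] never reads [+oo - +oo]. *)
Lemma integralD_defined d (T : measurableType d) (R : realType)
    (mu : {measure set T -> \bar R}) (f : T -> R) (g : T -> \bar R) :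
  measurable_fun [set: T] f -> measurable_fun [set: T] g ->
  integral_defined mu (EFin \o f) -> integral_defined mu g ->
  \int[mu]_x (f x)%:E +? \int[mu]_x g x ->
  \int[mu]_x ((f x)%:E + g x) = \int[mu]_x (f x)%:E + \int[mu]_x g x.
Proof.
move=> mf mg df dg.
rewrite (integralE _ _ (EFin \o f)) (integralE _ _ g) => fg.
have mf' : measurable_fun [set: T] (EFin \o f) by exact/measurable_EFinP.
have mh : measurable_fun [set: T] (fun x => (f x)%:E + g x).
  exact: emeasurable_funD.
pose h x := (f x)%:E + g x.
have mhp := measurable_funepos mh.
have mhn := measurable_funeneg mh.
have mfp := measurable_funepos mf'.
have mfn := measurable_funeneg mf'.
have mgp := measurable_funepos mg.
have mgn := measurable_funeneg mg.
have key := funepos_funeneg_EFinD f g.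
rewrite (integralE _ _ h).
apply: posneg_parts_add => //; try by apply: integral_ge0 => x _.
- rewrite -!ge0_integralD//; try by move=> x _; rewrite adde_ge0.
  + by apply: eq_integral => x _; have [->] := key x.
  + exact: emeasurable_funD.
  + exact: emeasurable_funD.
- rewrite -ge0_integralD//; apply: ge0_le_integral => //; last first.
    by move=> x _; have [] := key x.
  exact: emeasurable_funD.
- rewrite -ge0_integralD//; apply: ge0_le_integral => //; last first.
    by move=> x _; have [] := key x.
  exact: emeasurable_funD.
Qed.

(** * The bounded loss condition and the logarithmic moment generating function *)

Lemma bounded_loss_ae dZ dF (Z : measurableType dZ) (F : measurableType dF)
    (R : realType) (P : probability Z R) (loss : F -> Z -> R) (fstar f : F) :
  bounded_loss P loss ->
  {ae P, forall z, (`|excess_loss loss fstar f z| <= 2^-1)%R}.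
Proof.
move=> bl; have /ess_supP : ess_sup P (fun z => `|loss f z - loss fstar z|%:E)
    <= (2^-1)%:E.
  apply: le_trans bl; apply: ereal_sup_ubound.
  by exists (f, fstar).
by apply: filterS => z; rewrite lee_fin.
Qed.

Lemma integral_expR_bounds d (T : measurableType d) (R : realType)
    (P : probability T R) (u : T -> R) (b : R) :
  measurable_fun [set: T] u -> {ae P, forall x, (`|u x| <= b)%R} ->
  (expR (- b))%:E <= \int[P]_x (expR (u x))%:E <= (expR b)%:E.
Proof.
move=> mu ub.
have mexp : measurable_fun [set: T] (fun x => (expR (u x))%:E).
  by apply/measurable_EFinP; exact: measurableT_comp.
have cstE (k : R) : \int[P]_x (cst k%:E x) = k%:E.
  by rewrite integral_cst//= probability_setT mule1.
rewrite -(cstE (expR (- b))) -(cstE (expR b)).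
have ge0 (v : T -> R) x : [set: T] x -> 0 <= (expR (v x))%:E.
  by move=> _; rewrite lee_fin expR_ge0.
apply/andP; split; apply: ae_ge0_le_integral => //; try exact: ge0.
all: try by move=> ? _ /=; rewrite lee_fin expR_ge0.
- apply: filterS ub => x; rewrite ler_norml => /andP[? _] _.
  by rewrite lee_fin ler_expR.
- apply: filterS ub => x; rewrite ler_norml => /andP[_ ?] _.
  by rewrite lee_fin ler_expR.
Qed.

Section log_moment_generating_function.
Context dZ dF (Z : measurableType dZ) (F : measurableType dF) (R : realType).
Variables (P : probability Z R) (loss : F -> Z -> R) (fstar : F) (eta : R).
Hypothesis loss_meas : measurable_fun [set: F * Z] (fun fz => loss fz.1 fz.2).
Hypothesis loss_bounded : bounded_loss P loss.
Hypothesis eta_gt0 : (0 < eta)%R.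

Let mgf f := \int[P]_z (expR (- (eta * excess_loss loss fstar f z)))%:E.

(** Kept real-valued so that it can be a finite term of the exponents below; [fine] loses nothing,
    as [mgf f] lies between two positive reals. *)
Definition log_mgf f : R := ln (fine (mgf f)).

Lemma measurable_excess_loss :
  measurable_fun [set: F * Z] (fun fz => excess_loss loss fstar fz.1 fz.2).
Proof.
apply: measurable_funB => //.
have mpair : measurable_fun [set: F * Z] (fun fz => (fstar, fz.2)).
  by apply: measurable_fun_pair => //; exact: measurable_snd.
exact: measurableT_comp loss_meas mpair.
Qed.

Let measurable_excess_loss1 f :
  measurable_fun [set: Z] (excess_loss loss fstar f).
Proof. exact: measurableT_comp measurable_excess_loss (pair1_measurable f). Qed.

Let mgf_bounds f : (expR (- (eta / 2)))%:E <= mgf f <= (expR (eta / 2))%:E.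
Proof.
apply: integral_expR_bounds.
  by apply: measurable_funN; apply: measurable_funM.
have := bounded_loss_ae fstar f loss_bounded; apply: filterS => z h.
by rewrite normrN normrM gtr0_norm// ler_pM2l.
Qed.

Lemma mgfE f : mgf f = (expR (log_mgf f))%:E.
Proof.
have /andP[lb ub] := mgf_bounds f.
have ffin : mgf f \is a fin_num.
  rewrite fin_numElt; apply/andP; split; last exact: le_lt_trans ub (ltry _).
  exact: lt_le_trans (ltNyr _) lb.
rewrite lnK ?fineK// posrE -lte_fin fineK//.
by apply: lt_le_trans lb; rewrite lte_fin expR_gt0.
Qed.

Lemma normr_log_mgf_le f : (`|log_mgf f| <= eta / 2)%R.
Proof.
have := mgf_bounds f; rewrite mgfE !lee_fin !ler_expR => /andP[? ?].
by rewrite ler_norml; apply/andP.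
Qed.

Lemma measurable_log_mgf : measurable_fun [set: F] log_mgf.
Proof.
apply: measurableT_comp => //; apply: measurableT_comp.
  exact: fine_measurable.
(* By Tonelli, integrating out [z] from a nonnegative jointly measurable function leaves a
   measurable function of [f]. *)
apply: (measurable_fun_fubini_tonelli_F (m2 := P)
  (fun fz : F * Z => (expR (- (eta * excess_loss loss fstar fz.1 fz.2)))%:E)).
  apply/measurable_EFinP; apply: measurableT_comp => //.
  apply: measurable_funN; apply: measurable_funM => //.
  exact: measurable_excess_loss.
by move=> fz; rewrite lee_fin expR_ge0.
Qed.

Lemma annealed_excess_loss f :
  annealed P eta (excess_loss loss fstar f) = (- (eta^-1 * log_mgf f))%:E.
Proof. by rewrite /annealed -/(mgf f) mgfE lne_EFin ?expR_gt0// expRK. Qed.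

Lemma lne_norm_const n f :
  lne (norm_const P loss fstar n eta f) = (n%:R * log_mgf f)%:E.
Proof.
rewrite /norm_const.
(* The exponential turns the sum over the sample into a product of one-coordinate factors, the form
   required by [integral_iid_prod]. *)
under eq_integral do rewrite /excess_loss_sum mulr_sumr -sumrN expR_sum.
rewrite (integral_iid_prod P n
  (g := fun z => expR (- (eta * excess_loss loss fstar f z)))).
- by rewrite -/(mgf f) mgfE -EFin_expe -expRM_natl lne_EFin ?expR_gt0// expRK.
- apply: measurableT_comp => //.
  by apply: measurable_funN; apply: measurable_funM.
- by move=> z; exact: expR_ge0.
Qed.

Lemma integrable_log_mgf (mu : {measure set F -> \bar R}) :
  mu [set: F] < +oo -> mu.-integrable [set: F] (EFin \o log_mgf).
Proof.
move=> mu_fin; apply: measurable_bounded_integrable => //.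
- exact: measurable_log_mgf.
- exists (eta / 2)%R; split; first exact: num_real.
  by move=> x xb f _; rewrite /= (le_trans (normr_log_mgf_le f))// ltW.
Qed.

Lemma measurable_excess_loss_sum n :
  measurable_fun [set: n.-tuple Z * F]
    (fun zf => excess_loss_sum loss fstar zf.2 zf.1).
Proof.
apply: measurable_sum => i.
have mpair : measurable_fun [set: n.-tuple Z * F]
    (fun zf => (zf.2, tnth zf.1 i)).
  apply: measurable_fun_pair; first exact: measurable_snd.
  exact: measurableT_comp (measurable_tnth i) measurable_fst.
exact: measurableT_comp measurable_excess_loss mpair.
Qed.

End log_moment_generating_function.

(** * Extended-real algebra of the two exponents *)

(** Here [E], [W] and [a] play the posterior integrals of the empirical excess loss, of [- log w]
    and of [log_mgf], and [ls] plays [log S]. For finite [E] and [W] this is a field identity;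
    otherwise both sides are the same infinity. *)
Lemma esi_exponentE (R : realType) (n : nat) (eta a ls : R) (E W : \bar R) :
  (0 < n)%N -> (0 < eta)%R ->
  (eta^-1)%:E * (W + ls%:E) +? E ->
  (n%:R * eta)%:E * ((- (eta^-1 * a))%:E
    - (n%:R^-1)%:E * ((eta^-1)%:E * (W + ls%:E) + E)) =
  - (eta%:E * E + (n%:R * a)%:E + W) + (- ls)%:E.
Proof.
move=> n0 eta0.
have N0 : (0 < n%:R :> R)%R by rewrite ltr0n.
have [p1 p2] := pmule_infty (mulr_gt0 N0 eta0).
have [q1 q2] := pmule_infty (etrans (invr_gt0 _) N0).
have [r1 r2] := pmule_infty (etrans (invr_gt0 _) eta0).
have [s1 s2] := pmule_infty eta0.
case: W E => [W| |] [E| |] //=;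
  rewrite ?(p1, p2, q1, q2, r1, r2, s1, s2) //= => _;
  rewrite ?(p1, p2, q1, q2, r1, r2, s1, s2) //=.
by congr EFin; field; rewrite !gt_eqF.
Qed.

(** Positive factors and finite shifts do not change which terms are infinite, so the definedness of
    [COMP_full] carries over to the exponent inside [Seta]. *)
Lemma esi_exponent_defined (R : realType) (eta a ls : R) (E W : \bar R) :
  (0 < eta)%R -> (eta^-1)%:E * (W + ls%:E) +? E -> eta%:E * E + a%:E +? W.
Proof.
move=> eta0; have [p1 p2] := pmule_infty eta0.
have [q1 q2] := pmule_infty (etrans (invr_gt0 _) eta0).
by case: W E => [W| |] [E| |] //=; rewrite ?(p1, p2, q1, q2).
Qed.

(** Additivity is applied twice. Splitting [e] from [c] is safe because the integral of [c] is
    finite; splitting off [g], the role of [- log w], rests on [esi_exponent_defined]. The first two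
    terms are grouped so that the left summand stays real-valued. *)
Lemma integral_esi_exponent d (T : measurableType d) (R : realType)
    (mu : {measure set T -> \bar R}) (eta k ls : R) (e c : T -> R)
    (g : T -> \bar R) :
  (0 < eta)%R ->
  measurable_fun [set: T] e -> measurable_fun [set: T] g ->
  integral_defined mu (EFin \o e) -> integral_defined mu g ->
  mu.-integrable [set: T] (EFin \o c) ->
  (eta^-1)%:E * (\int[mu]_x g x + ls%:E) +? \int[mu]_x (e x)%:E ->
  \int[mu]_x ((eta * e x + k * c x)%:E + g x) =
  eta%:E * \int[mu]_x (e x)%:E + (k * fine (\int[mu]_x (c x)%:E))%:E
    + \int[mu]_x g x.
Proof.
move=> eta0 me mg de dg ic def.
have mc : measurable_fun [set: T] c.
  by apply/measurable_EFinP; exact: measurable_int ic.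
have mE : measurable_fun [set: T] (EFin \o e) by exact/measurable_EFinP.
have mee : measurable_fun [set: T] (fun x => eta * e x)%R.
  exact: measurable_funM.
have mkc : measurable_fun [set: T] (fun x => k * c x)%R.
  exact: measurable_funM.
have dee : integral_defined mu (EFin \o (fun x => eta * e x)%R).
  exact: (integral_definedZl eta0 mE de).
have ikc : mu.-integrable [set: T] (EFin \o (fun x => k * c x)%R).
  exact: (integrableZl measurableT k ic).
have IcE : \int[mu]_x (k * c x)%:E = (k * fine (\int[mu]_x (c x)%:E))%:E.
  under eq_integral do rewrite EFinM.
  rewrite integralZl// [RHS]EFinM fineK//.
  exact: (integrable_fin_num measurableT ic).
have IeE : \int[mu]_x (eta * e x)%:E = eta%:E * \int[mu]_x (e x)%:E.
  by under eq_integral do rewrite EFinM; rewrite integralZl_pos.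
have IecE : \int[mu]_x (eta * e x + k * c x)%:E =
    eta%:E * \int[mu]_x (e x)%:E + (k * fine (\int[mu]_x (c x)%:E))%:E.
  under eq_integral do rewrite EFinD.
  rewrite integralD_defined// ?IeE ?IcE//.
  - exact/measurable_EFinP.
  - by left; apply: integral_funepos_lt_pinfty => //; exact: ikc.
  - by rewrite fin_num_adde_defl.
rewrite integralD_defined// ?IecE//.
- exact: measurable_funD.
- exact: (integral_definedD mee dee ikc).
- exact: esi_exponent_defined def.
Qed.

(** Lowering the exponent by [ln s] divides the exponential by [s]. Agreement almost everywhere
    suffices, both integrands being nonnegative and measurable. *)
Lemma integral_expeR_normalized d (T : measurableType d) (R : realType)
    (mu : {measure set T -> \bar R}) (s : R) (u v : T -> \bar R) :
  (0 < s)%R -> measurable_fun [set: T] u -> measurable_fun [set: T] v ->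
  \int[mu]_x expeR (v x) = s%:E ->
  {ae mu, forall x, u x = v x + (- ln s)%:E} ->
  \int[mu]_x expeR (u x) = 1.
Proof.
move=> s0 mu' mv vs uv.
have meu := measurableT_comp (@measurable_expeR R) mu'.
have mev := measurableT_comp (@measurable_expeR R) mv.
rewrite (@ge0_ae_eq_integral _ _ _ mu _ _ (fun x => (s^-1)%:E * expeR (v x)))//.
- rewrite ge0_integralZl// ?lee_fin ?invr_ge0 ?(ltW s0)//.
    by rewrite vs -EFinM mulVf// gt_eqF.
  by move=> x _; exact: expeR_ge0.
- exact: measurable_funeM.
- by move=> x _; exact: expeR_ge0.
- by move=> x _; rewrite mule_ge0 ?expeR_ge0// lee_fin invr_ge0 ltW.
- apply: filterS uv => x -> _.
  by rewrite expeRD muleC /= expRN lnK.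
Qed.

(** * Comparison of the exponent of the inequality with the one integrated by [Seta] *)

Theorem theorem4 (R : realType) (dX dY dF : measure_display)
    (X : measurableType dX) (Y : measurableType dY) (F : measurableType dF)
    (P : probability (X * Y)%type R)
    (loss : F -> X * Y -> R)
    (loss_meas : measurable_fun [set: F * (X * Y)] (fun fz => loss fz.1 fz.2))
    (risk_def : forall f, integral_defined P (fun z => (loss f z)%:E))
    (fstar : F) (fstar_min : risk_minimizer P loss fstar)
    (loss_bounded : bounded_loss P loss)
    (n : nat) (n_ge1 : (1 <= n)%N) (eta : R) (eta_gt0 : (0 < eta)%R)
    (Pi : R.-pker (n.-tuple (X * Y)) ~> F)
    (w : n.-tuple (X * Y) -> F -> R)
    (w_ge0 : forall zn f, (0 <= w zn f)%R)
    (w_meas : measurable_fun [set: n.-tuple (X * Y) * F]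
                (fun zf => w zf.1 zf.2))
    (excess_def : {ae iid P n, forall zn, integral_defined (Pi zn)
                    (fun f => (excess_loss_sum loss fstar f zn)%:E)})
    (logw_def : {ae iid P n, forall zn, integral_defined (Pi zn)
                    (fun f => - lne (w zn f)%:E)})
    (COMP_full_def : {ae iid P n, forall zn,
        COMP P loss fstar eta Pi w zn
        +? \int[Pi zn]_f (excess_loss_sum loss fstar f zn)%:E})
    (S_gt0 : 0 < Seta P loss fstar eta Pi w)
    (S_fin : Seta P loss fstar eta Pi w < +oo) :
  esi_eq (iid P n) (n%:R * eta)
    (fun zn => \int[Pi zn]_f annealed P eta (excess_loss loss fstar f))
    (fun zn => (n%:R^-1)%:E * COMP_full P loss fstar eta Pi w zn).
Proof.
have [s s_gt0 SE] : exists2 s, (0 < s)%R & Seta P loss fstar eta Pi w = s%:E.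
  by move: S_gt0 S_fin; case: Seta => [s| |]// s0 _; exists s.
pose c := log_mgf P loss fstar eta.
pose excess (zn : n.-tuple (X * Y)) f := excess_loss_sum loss fstar f zn : R.
have excess_meas : measurable_fun [set: n.-tuple (X * Y) * F]
    (fun zf => excess zf.1 zf.2) by exact: measurable_excess_loss_sum.
have c_meas : measurable_fun [set: F] c by exact: measurable_log_mgf.
have c_int zn : (Pi zn).-integrable [set: F] (EFin \o c).
  by apply: integrable_log_mgf => //; rewrite prob_kernel ltry.
have logw_meas : measurable_fun [set: n.-tuple (X * Y) * F]
    (fun zf => - lne (w zf.1 zf.2)%:E).
  have wE_meas : measurable_fun [set: n.-tuple (X * Y) * F]
      (fun zf => (w zf.1 zf.2)%:E) by exact/measurable_EFinP.
  have lw_meas := measurableT_comp (@measurable_lne R) wE_meas.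
  exact: (measurableT_comp (@oppe_measurable R setT) lw_meas).
(* The posterior mean of the annealed risk is always finite, since [c] is integrable; the real form
   is the one appearing in [esi_exponentE]. *)
have annealedE zn : \int[Pi zn]_f annealed P eta (excess_loss loss fstar f) =
    (- (eta^-1 * fine (\int[Pi zn]_f (c f)%:E)))%:E.
  transitivity (\int[Pi zn]_f ((- eta^-1)%:E * (c f)%:E)).
    by apply: eq_integral => f _; rewrite annealed_excess_loss// -EFinM mulNr.
  rewrite (integralZl measurableT (c_int zn)) -mulNr EFinM fineK//.
  exact: (integrable_fin_num measurableT (c_int zn)).
(* The posterior integral in [Seta], with [log C(f)] replaced by [n * c f] and the real-valued terms
   grouped as in [integral_esi_exponent]. *)
pose inner zn := \int[Pi zn]_f
  ((eta * excess zn f + n%:R * c f)%:E + (- lne (w zn f)%:E)).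
have inner_meas : measurable_fun [set: n.-tuple (X * Y)] inner.
  apply: (@measurable_integral_kernel _ _ _ _ _ Pi (fun zn f =>
    (eta * excess zn f + n%:R * c f)%:E + (- lne (w zn f)%:E))).
  apply: emeasurable_funD logw_meas; apply/measurable_EFinP.
  apply: measurable_funD.
    exact: measurable_funM (measurable_cst eta) excess_meas.
  apply: measurable_funM (measurable_cst _) _.
  exact: measurableT_comp c_meas measurable_snd.
have SetaE : \int[iid P n]_zn expeR (- inner zn) = s%:E.
  rewrite -SE; apply: eq_integral => zn _; congr (expeR (- _)).
  by apply: eq_integral => f _; rewrite lne_norm_const.
have int_excess_meas : measurable_fun [set: n.-tuple (X * Y)]
    (fun zn => \int[Pi zn]_f (excess zn f)%:E).
  apply: (@measurable_integral_kernel _ _ _ _ _ Pi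
    (fun zn f => (excess zn f)%:E)); exact/measurable_EFinP.
have int_logw_meas := @measurable_integral_kernel _ _ _ _ _ Pi
  (fun zn f => - lne (w zn f)%:E) logw_meas.
have int_c_meas : measurable_fun [set: n.-tuple (X * Y)]
    (fun zn => \int[Pi zn]_f (c f)%:E).
  apply: (@measurable_integral_kernel _ _ _ _ _ Pi (fun _ f => (c f)%:E)).
  apply/measurable_EFinP; exact: measurableT_comp c_meas measurable_snd.
(* The role of [v] is played by [- inner], whose exponential integrates to [s]; it remains to see
   that the target exponent is [- inner - ln s] almost surely. *)
apply: (integral_expeR_normalized s_gt0 _ _ SetaE).
- apply: measurable_funeM; apply: emeasurable_funB.
    under eq_fun do rewrite annealedE.
    apply/measurable_EFinP; apply: measurable_funN.
    apply: measurable_funM (measurable_cst _) _.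
    exact: measurableT_comp (fine_measurable measurableT) int_c_meas.
  apply: measurable_funeM; apply: emeasurable_funD int_excess_meas.
  apply: measurable_funeM; apply: emeasurable_funD int_logw_meas _.
  exact: measurable_cst.
- exact: (measurableT_comp (@oppe_measurable R setT) inner_meas).
(* The three definedness hypotheses hold jointly outside a null set of samples. There
   [esi_exponentE] rewrites the target exponent, and [integral_esi_exponent], read backwards,
   reassembles [inner]. *)
- apply: filterS3 excess_def logw_def COMP_full_def => zn dE dW.
  rewrite annealedE /COMP_full /COMP SE lne_EFin// => dC.
  rewrite (esi_exponentE _ n_ge1 eta_gt0 dC); congr (- _ + _).
  rewrite -(integral_esi_exponent n%:R eta_gt0 _ _ dE dW (c_int zn) dC)//.
  - exact: measurableT_comp excess_meas (pair1_measurable zn).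
  - exact: measurableT_comp logw_meas (pair1_measurable zn).
Qed.
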